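(* Let $n\ge 2$ be an integer and let $L_n=\langle a,t \mid a^n,\ [t^{i}at^{-i},t^{j}at^{-j}]\ (i,j\in\mathbb{Z})\rangle$ be the lamplighter group. Then $L_n$ contains seesaw words of arbitrary swing with respect to the generator $t$ in the generating set $\{a,t\}$; that is, for every positive integer $k$ there is an element of $L_n$ which is a seesaw word of swing $k$ with respect to $t$ in the generating set $\{a,t\}$.
   Context: Let $G$ be a group with finite generating set $X$ and let $|\cdot|$ be word length with respect to $X$. An element $w\in G$ is a seesaw word of swing $k$ with respect to a generator $g\in X$ (in the generating set $X$) if the following hold. (1) $g$ is the unique element of $X$ with $|wg^{\pm1}|=|w|-1$ (for both signs), and for all other $h\in X$ we have $|wh^{\pm1}|\ge|w|$ (for both signs). (2) For all integers $l\in[1,k-1]$ we have $|wg^{l}|=|wg^{l-1}|-1$, and $|wg^{l-1}h^{\pm1}|\ge|wg^{l-1}|$ for all $h\in X$ with $h\ne g$; and the analogous condition holds with $g$ replaced by $g^{-1}$, i.e. for all integers $l\in[1,k-1]$, $|wg^{-l}|=|wg^{-(l-1)}|-1$ and $|wg^{-(l-1)}h^{\pm1}|\ge|wg^{-(l-1)}|$ for all $h\in X$ with $h\ne g$. *)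

(* Defs.v *)
From HB Require Import structures.
From mathcomp Require Import all_boot all_order all_algebra.
From mathcomp Require Import boolp classical_sets cardinality.

Set Implicit Arguments.
Unset Strict Implicit.
Unset Printing Implicit Defensive.

Local Open Scope quotient_scope.
Local Open Scope group_scope.

(* A letter (x, false) stands for the generator x, and (x, true) for its
   formal inverse. *)
Definition word (I : Type) : Type := seq (I * bool).

Definition winv (I : Type) (u : word I) : word I :=
  rev [seq (p.1, ~~ p.2) | p <- u].

Definition wexp (I : Type) (x : I) (i : int) : word I :=
  match i with
  | Posz m => nseq m (x, false)
  | Negz m => nseq m.+1 (x, true)
  end.

Definition wcomm (I : Type) (u v : word I) : word I :=
  winv u ++ winv v ++ u ++ v.

Inductive pres_cong (I : Type) (R : set (word I)) : word I -> word I -> Prop :=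
| pres_refl u : pres_cong R u u
| pres_sym u v : pres_cong R u v -> pres_cong R v u
| pres_trans u v w : pres_cong R u v -> pres_cong R v w -> pres_cong R u w
| pres_cat u u' v v' :
    pres_cong R u u' -> pres_cong R v v' -> pres_cong R (u ++ v) (u' ++ v')
| pres_cancel x b : pres_cong R [:: (x, b); (x, ~~ b)] [::]
| pres_rel r : R r -> pres_cong R r [::].

Section PresentedGroup.
Variables (I : choiceType) (R : set (word I)).

Let congb (u v : seq (I * bool)) : bool := `[< pres_cong R u v >].

Let congb_refl : reflexive congb.
Proof. by move=> u; apply/asboolP; apply: pres_refl. Qed.

Let congb_sym : symmetric congb.
Proof.
by move=> u v; apply/asboolP/asboolP; apply: pres_sym.
Qed.

Let congb_trans : transitive congb.
Proof.
move=> v u w /asboolP uv /asboolP vw; apply/asboolP; exact: pres_trans uv vw.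
Qed.

Canonical pres_equiv := EquivRel congb congb_refl congb_sym congb_trans.

Definition presented : Type := {eq_quot pres_equiv}.

HB.instance Definition _ := Choice.on presented.
HB.instance Definition _ := EqQuotient.on presented.

Definition pres_class (u : word I) : presented := \pi_presented u.

Lemma pres_classW (P : presented -> Prop) :
  (forall u, P (pres_class u)) -> forall x, P x.
Proof. exact: quotW. Qed.

Lemma pres_eqP (u v : word I) :
  pres_class u = pres_class v <-> pres_cong R u v.
Proof.
split=> [/eqP|uv]; first by rewrite /pres_class eqmodE => /asboolP.
by apply/eqP; rewrite /pres_class eqmodE; apply/asboolP.
Qed.

Lemma winv_cat (u v : word I) : winv (u ++ v) = winv v ++ winv u.
Proof. by rewrite /winv map_cat rev_cat. Qed.

Lemma winvK : involutive (@winv I).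
Proof.
move=> u; rewrite /winv map_rev revK -map_comp -[RHS]map_id.
by apply: eq_map => -[x b] /=; rewrite negbK.
Qed.

Lemma pres_mulwV (u : word I) : pres_cong R (u ++ winv u) [::].
Proof.
elim: u => [|[x b] u IHu]; first exact: pres_refl.
rewrite -[(x, b) :: u]cat1s winv_cat.
apply: pres_trans (pres_cancel R x b).
rewrite -(cat1s (x, b) [:: _]) -[[:: (x, ~~ b)]]/(winv [:: (x, b)]) -!catA.
apply: pres_cat; first exact: pres_refl.
rewrite catA -[X in pres_cong R _ X]cat0s.
by apply: pres_cat => //; apply: pres_refl.
Qed.

Lemma pres_mulVw (u : word I) : pres_cong R (winv u ++ u) [::].
Proof. by rewrite -{2}[u]winvK; apply: pres_mulwV. Qed.

Lemma pres_winv (u v : word I) :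
  pres_cong R u v -> pres_cong R (winv u) (winv v).
Proof.
move=> uv.
have uE : pres_cong R (winv u ++ (v ++ winv v)) (winv u).
  rewrite -[X in pres_cong R _ X]cats0.
  by apply: pres_cat; [apply: pres_refl | apply: pres_mulwV].
apply: pres_trans (pres_sym uE) _; rewrite catA -[X in pres_cong R _ X]cat0s.
apply: pres_cat; last exact: pres_refl.
apply: pres_trans (pres_mulVw u).
by apply: pres_cat; [apply: pres_refl | apply: pres_sym].
Qed.

Definition pres_mul (x y : presented) : presented := pres_class (repr x ++ repr y).
Definition pres_one : presented := pres_class [::].
Definition pres_inv (x : presented) : presented := pres_class (winv (repr x)).

Lemma pres_repr (u : word I) :
  pres_cong R (repr (pres_class u)) u.
Proof. by apply/pres_eqP; exact: reprK. Qed.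

Lemma pres_mulE u v :
  pres_mul (pres_class u) (pres_class v) = pres_class (u ++ v).
Proof. by apply/pres_eqP; apply: pres_cat; apply: pres_repr. Qed.

Lemma pres_invE u : pres_inv (pres_class u) = pres_class (winv u).
Proof. by apply/pres_eqP; apply: pres_winv; apply: pres_repr. Qed.

Lemma pres_mulgA : associative pres_mul.
Proof.
move=> x y z; elim/pres_classW: x => u; elim/pres_classW: y => v; elim/pres_classW: z => w.
by rewrite !pres_mulE catA.
Qed.

Lemma pres_mul1g : left_id pres_one pres_mul.
Proof. by move=> x; elim/pres_classW: x => u; rewrite pres_mulE. Qed.

Lemma pres_mulg1 : right_id pres_one pres_mul.
Proof. by move=> x; elim/pres_classW: x => u; rewrite pres_mulE cats0. Qed.

Lemma pres_mulVg : left_inverse pres_one pres_inv pres_mul.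
Proof.
by move=> x; elim/pres_classW: x => u; rewrite pres_invE pres_mulE; apply/pres_eqP/pres_mulVw.
Qed.

Lemma pres_mulgV : right_inverse pres_one pres_inv pres_mul.
Proof.
by move=> x; elim/pres_classW: x => u; rewrite pres_invE pres_mulE; apply/pres_eqP/pres_mulwV.
Qed.

HB.instance Definition _ := isGroup.Build presented
  pres_mulgA pres_mul1g pres_mulg1 pres_mulVg pres_mulgV.

Definition pres_gen (x : I) : presented := pres_class [:: (x, false)].

Lemma pres_piE (u : word I) :
  pres_class u =
  \prod_(p <- u) (if p.2 then (pres_gen p.1)^-1 else pres_gen p.1).
Proof.
elim: u => [|[x b] u IHu]; first by rewrite big_nil.
rewrite big_cons -IHu -cat1s -pres_mulE /=; congr (_ * _).
by case: b => //; rewrite [RHS]pres_invE.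
Qed.

End PresentedGroup.

Definition spells (G : groupType) (X : set G) (s : seq G) (w : G) : Prop :=
  (forall x, x \in s -> X x \/ X x^-1) /\ w = \prod_(x <- s) x.

Record finite_genset (G : groupType) := FiniteGenset {
  gens : set G;
  gens_finite : finite_set gens;
  gens_generate : forall w : G, exists s, spells gens s w
}.

Section WordLength.
Variables (G : groupType) (X : finite_genset G).

Lemma word_length_subproof (w : G) :
  exists m, `[< exists s, size s = m /\ spells (gens X) s w >].
Proof.
have [s sw] := gens_generate X w.
by exists (size s); apply/asboolP; exists s.
Qed.

Definition word_length (w : G) : nat := ex_minn (word_length_subproof w).

End WordLength.

(* The condition |u| = |v| - 1 is written |u| + 1 = |v|, since subtraction on
   nat is truncated. *)
Section Seesaw.
Variables (G : groupType) (X : finite_genset G).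
Local Notation len := (word_length X).

Definition shortens (w h : G) : Prop :=
  (len (w * h)).+1 = len w /\ (len (w * h^-1)).+1 = len w.

(* e is g or g^-1 *)
Definition seesaw_side (k : nat) (w g e : G) : Prop :=
  forall l : nat, 1 <= l <= k - 1 ->
    (len (w * e ^+ l)).+1 = len (w * e ^+ (l - 1)) /\
    forall h, gens X h -> h <> g ->
      len (w * e ^+ (l - 1)) <= len (w * e ^+ (l - 1) * h) /\
      len (w * e ^+ (l - 1)) <= len (w * e ^+ (l - 1) * h^-1).

Definition seesaw_word (k : nat) (w g : G) : Prop :=
  [/\ unique (fun h => gens X h /\ shortens w h) g,
      forall h, gens X h -> h <> g ->
        len w <= len (w * h) /\ len w <= len (w * h^-1),
      seesaw_side k w g g &
      seesaw_side k w g g^-1].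

End Seesaw.

Inductive lamp_letter := LA | LT.

Definition bool_of_lamp_letter x := if x is LA then true else false.
Definition lamp_letter_of_bool (b : bool) := if b then LA else LT.
Lemma bool_of_lamp_letterK : cancel bool_of_lamp_letter lamp_letter_of_bool.
Proof. by case. Qed.

HB.instance Definition _ :=
  Countable.copy lamp_letter (can_type bool_of_lamp_letterK).

Definition lamp_conj (i : int) : word lamp_letter :=
  wexp LT i ++ wexp LA (Posz 1) ++ wexp LT (- i)%R.

Inductive lamp_relator (n : nat) : word lamp_letter -> Prop :=
| lamp_relator_order : lamp_relator n (wexp LA (Posz n))
| lamp_relator_comm (i j : int) :
    lamp_relator n (wcomm (lamp_conj i) (lamp_conj j)).

Definition lamplighter (n : nat) : groupType := presented (lamp_relator n).

Definition lamp_a (n : nat) : lamplighter n := pres_gen (lamp_relator n) LA.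
Definition lamp_t (n : nat) : lamplighter n := pres_gen (lamp_relator n) LT.

Lemma lamp_generate (n : nat) (w : lamplighter n) :
  exists s, spells [set lamp_a n; lamp_t n]%classic s w.
Proof.
elim/pres_classW: w => u.
exists [seq (if p.2 then (pres_gen (lamp_relator n) p.1)^-1
             else pres_gen (lamp_relator n) p.1) | p <- u].
split; last by rewrite big_map; exact: pres_piE.
move=> x /mapP[[y b] _ ->] /=.
have gy : [set lamp_a n; lamp_t n]%classic (pres_gen (lamp_relator n) y).
  by case: y; [left | right].
by case: b; [right; rewrite invgK | left].
Qed.

Definition lamp_gens (n : nat) : finite_genset (lamplighter n) :=
  FiniteGenset (finite_set2 (lamp_a n) (lamp_t n)) (@lamp_generate n).

(* Main.v *)
Require Import Defs.
From mathcomp Require Import all_boot.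
From mathcomp Require Import ssralg ssrint zmodp boolp classical_sets.
From mathcomp Require Import zify.

(** The seesaw word of swing k is w = t^-k a t^(2k) a t^-k: the lamplighter
    starts at the origin, lights the lamps at -k and k, and comes home.

    An element of the group determines the final position of the lamplighter
    (cursor) and the state of every lamp, read modulo n (lamp). Any word whose
    element has the lamps k and -k alight and the lamplighter at p must contain
    two lighting letters, and a walk on the integers from 0 to p through both k
    and -k. Such a walk has at least 4k - |p| steps, because it sweeps the
    segment [-k, k], and in addition covers the distance from 0 to the end it
    visits first and from the end it visits last to p. Hence such an element has
    length at least 4k + 2 - |p| (walk_tour, len_lower).

    For |p| <= k the bound is attained by w t^p: when p >= 0 light the lamp at
    -k first and stop short on the way back from k; when p <= 0 do the same
    with the two sides exchanged (len_upper). Exchanging the sides is harmless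
    because the lamps commute, so w is unchanged when t is replaced by its
    inverse (tourV). So the length of w t^p is exactly 4k + 2 - |p|, and it drops by
    one at each of the first k steps in either direction. A letter a or a^-1
    played at a position p with |p| < k leaves the lamps k and -k and the
    position alone, so the lower bound still applies and the length cannot
    drop (len_tour_lower).

    What remains is that cursor and lamp are well defined on the presented
    group, i.e. that they respect the defining relators (pres_cong_config). *)

Set Implicit Arguments.
Unset Strict Implicit.
Unset Printing Implicit Defensive.

(** * The configuration read off a word *)

Section Configuration.
Import GRing.Theory.
Local Open Scope ring_scope.
Variable n : nat.

Definition letter_shift (x : lamp_letter * bool) : int :=
  if x.1 is LT then (if x.2 then -1 else 1) else 0.

Definition letter_lamp (i : int) (x : lamp_letter * bool) : 'Z_n :=
  if x.1 is LA then (if i == 0 then (if x.2 then -1 else 1) else 0) else 0.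

Definition word_pos (u : word lamp_letter) : int := \sum_(x <- u) letter_shift x.

(** Indexed by the position relative to the current one: moving the lamplighter
    shifts the index instead of carrying a starting position along. *)
Fixpoint word_lamp (i : int) (u : word lamp_letter) : 'Z_n :=
  if u is x :: v then letter_lamp i x + word_lamp (i - letter_shift x) v else 0.

Lemma word_pos_cons x u : word_pos (x :: u) = letter_shift x + word_pos u.
Proof. by rewrite /word_pos big_cons. Qed.

Lemma word_pos_cat u v : word_pos (u ++ v) = word_pos u + word_pos v.
Proof. by rewrite /word_pos big_cat. Qed.

(** The composition law of the wreath product: the second word is played from
    the place where the first one stops. *)
Lemma word_lamp_cat i u v :
  word_lamp i (u ++ v) = word_lamp i u + word_lamp (i - word_pos u) v.
Proof.
elim: u i => [|x u IHu] i /=; first by rewrite /word_pos big_nil subr0 add0r.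
by rewrite IHu word_pos_cons addrA opprD addrA.
Qed.

Lemma winv_cons (x : lamp_letter * bool) u :
  winv (x :: u) = winv u ++ [:: (x.1, ~~ x.2)].
Proof. by rewrite /winv /= rev_cons cats1. Qed.

Lemma word_pos_winv u : word_pos (winv u) = - word_pos u.
Proof.
elim: u => [|[x b] u IHu]; first by rewrite /word_pos !big_nil oppr0.
rewrite winv_cons word_pos_cat IHu !word_pos_cons /word_pos big_nil addr0.
by rewrite opprD addrC; case: x b => [] [].
Qed.

Lemma word_lamp_winv i u :
  word_lamp i (winv u) = - word_lamp (i + word_pos u) u.
Proof.
elim: u i => [|[x b] u IHu] i; first by rewrite /= oppr0.
rewrite winv_cons word_lamp_cat IHu word_pos_winv /= addr0 word_pos_cons opprD.
rewrite opprK addrC; congr (_ + - word_lamp _ u); last by lia.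
(* A letter that changes a lamp does not move, so the two indices agree. *)
case: x => /=; last by rewrite /letter_lamp oppr0.
rewrite /letter_lamp /letter_shift /= add0r.
by case: ifP => _; case: b; rewrite ?opprK ?oppr0.
Qed.

Lemma word_pos_wexpT (i : int) : word_pos (wexp LT i) = i.
Proof.
have E b m : word_pos (nseq m (LT, b)) = (if b then -1 else 1) *+ m.
  by rewrite /word_pos big_nseq iter_addr addr0.
case: i => m; rewrite /wexp E; first by rewrite natz.
by rewrite NegzE mulNrn natz.
Qed.

Lemma word_pos_lamp_conj i : word_pos (lamp_conj i) = 0.
Proof.
rewrite /lamp_conj !word_pos_cat !word_pos_wexpT.
by rewrite /word_pos big_cons big_nil /letter_shift /= !add0r subrr.
Qed.

(** Words that bring the lamplighter home act on the lamps by plain addition,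
    hence commute. *)
Lemma config_wcomm u v : word_pos u = 0 -> word_pos v = 0 ->
  word_pos (wcomm u v) = 0 /\ forall i, word_lamp i (wcomm u v) = 0.
Proof.
rewrite /wcomm => u0 v0; split=> [|i].
  by rewrite !word_pos_cat !word_pos_winv u0 v0.
rewrite !word_lamp_cat !word_lamp_winv !word_pos_winv u0 v0.
by rewrite !(subr0, addr0, oppr0) addrA addrACA !addNr addr0.
Qed.

(** Position and lamps depend only on the group element. Reading the lamps in
    'Z_n is what kills the relator a^n, and needs 1 < n since 'Z_n is the
    integers mod 2 for smaller n. *)
Lemma pres_cong_config (hn : (1 < n)%N) u v :
  pres_cong (lamp_relator n) u v ->
  word_pos u = word_pos v /\ forall i, word_lamp i u = word_lamp i v.
Proof.
elim=> {u v} [u|u v _ [E F]|u v w _ [E F] _ [E' F']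
             |u u' v v' _ [E F] _ [E' F']|x b|r].
- by [].
- by split=> // i; rewrite F.
- by split=> [|i]; rewrite ?E ?F.
- by split=> [|i]; rewrite ?word_pos_cat ?word_lamp_cat E ?E' // F F'.
- have -> : [:: (x, b); (x, ~~ b)] = [:: (x, b)] ++ winv [:: (x, b)] by [].
  split=> [|i]; first by rewrite word_pos_cat word_pos_winv subrr /word_pos big_nil.
  by rewrite word_lamp_cat word_lamp_winv subrK subrr.
- case=> [|i j].
    have E m : word_pos (nseq m (LA, false)) = 0.
      by rewrite /word_pos big_nseq iter_addr addr0 mul0rn.
    split=> [|i]; first by rewrite E /word_pos big_nil.
    have F m : word_lamp i (nseq m (LA, false)) = (i == 0)%:R *+ m.
      elim: m => [|m IHm] //=; rewrite subr0 IHm mulrS /letter_lamp /=.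
      by case: (i == 0).
    by rewrite F /=; case: (i == 0); rewrite ?mul0rn // pchar_Zp.
  have [P Q] := config_wcomm (word_pos_lamp_conj i) (word_pos_lamp_conj j).
  by split=> [|l]; rewrite ?P ?Q // /word_pos big_nil.
Qed.
End Configuration.

(** * Walks that must visit two opposite lamps *)

(** Only the wreath product composition law of cursor and lamp matters here, so
    the group is kept abstract. *)
Section LampWalk.
Import GRing.Theory.
Local Open Scope group_scope.
Variables (G : groupType) (V : zmodType).
Variables (cursor : G -> int) (lamp : int -> G -> V).
Hypothesis cursorM : forall x y, cursor (x * y) = (cursor x + cursor y)%R.
Hypothesis lampM : forall i x y,
  lamp i (x * y) = (lamp i x + lamp (i - cursor x) y)%R.

Lemma cursor1 : cursor 1 = 0%R.
Proof. by apply: (@addrI _ (cursor 1)); rewrite -cursorM mulg1 addr0. Qed.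

Lemma lamp1 i : lamp i 1 = 0%R.
Proof.
by apply: (@addrI _ (lamp i 1)); rewrite -{2}[i]subr0 -cursor1 -lampM mulg1 addr0.
Qed.

Lemma cursorV x : cursor x^-1 = (- cursor x)%R.
Proof. by apply: (@addrI _ (cursor x)); rewrite -cursorM mulgV cursor1 subrr. Qed.

Lemma lampV i x : lamp i x^-1 = (- lamp (i + cursor x) x)%R.
Proof.
apply: (@addrI _ (lamp (i + cursor x) x)).
by rewrite -{2}(addrK (cursor x) i) -lampM mulgV lamp1 subrr.
Qed.

Lemma cursorX x m : cursor (x ^+ m) = (cursor x *+ m)%R.
Proof. by elim: m => [|m IHm]; rewrite ?cursor1 // expgS cursorM IHm mulrS. Qed.

Lemma lampX x m : (forall i, lamp i x = 0%R) -> forall i, lamp i (x ^+ m) = 0%R.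
Proof.
move=> x0; elim: m => [|m IHm] i; first by rewrite lamp1.
by rewrite expgS lampM x0 IHm addr0.
Qed.

Definition prod (s : seq G) : G := \prod_(x <- s) x.

Lemma prod_nil : prod [::] = 1.
Proof. exact: big_nil. Qed.

Lemma prod_cons x s : prod (x :: s) = x * prod s.
Proof. exact: big_cons. Qed.

Lemma prod_split s1 x s2 : prod (s1 ++ x :: s2) = prod s1 * (x * prod s2).
Proof. by rewrite /prod big_cat big_cons. Qed.

(** What the generators and their inverses have in common: they move by at most
    one, and can change a lamp only at the current position and without
    moving. *)
Definition walk_step (x : G) := `|cursor x| <= 1 /\
  forall i, lamp i x != 0%R -> i = 0%R /\ cursor x = 0%R.

Definition walk (s : seq G) := forall x, x \in s -> walk_step x.

Lemma walk_stepV x : walk_step x -> walk_step x^-1.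
Proof.
case=> x1 xl; split=> [|i]; rewrite cursorV ?abszN // lampV oppr_eq0.
by move=> /xl[]; lia.
Qed.

Lemma walk_cat s1 s2 : walk (s1 ++ s2) -> walk s1 /\ walk s2.
Proof. by move=> s12; split=> x xs; apply: s12; rewrite mem_cat xs ?orbT. Qed.

Lemma walk_cons x s : walk (x :: s) -> walk_step x /\ walk s.
Proof.
by move=> xs; split=> [|y ys]; apply: xs; rewrite inE ?eqxx ?ys ?orbT.
Qed.

Lemma walk_cursor s : walk s -> `|cursor (prod s)| <= size s.
Proof.
elim: s => [|x s IHs]; first by rewrite prod_nil cursor1.
move=> /walk_cons[[x1 _] /IHs]; rewrite prod_cons cursorM /=; lia.
Qed.

(** To alter the lamp i a walk must at some time stand at i and spend there a
    letter that does not move. *)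
Lemma walk_visit s i : walk s -> lamp i (prod s) != 0%R ->
  exists s1 x s2, [/\ s = s1 ++ x :: s2, cursor (prod s1) = i,
    cursor x = 0%R & forall j, lamp j x != 0%R -> j = 0%R].
Proof.
elim: s i => [|x s IHs] i; first by rewrite prod_nil lamp1 eqxx.
move=> /walk_cons[[_ xl] ws].
rewrite prod_cons lampM; have [->|xi _] := eqVneq (lamp i x) 0%R.
  rewrite add0r => /(IHs _ ws)[s1 [y [s2 [-> s1i y0 yl]]]].
  exists (x :: s1), y, s2; split=> //.
  by rewrite prod_cons cursorM s1i addrC subrK.
have [i0 x0] := xl i xi; exists [::], x, s; split=> //.
  by rewrite prod_nil cursor1.
by move=> j /xl[].
Qed.

(** Cut the walk at a letter that changes the lamp k; the lamp -k is changed
    either before or after it. Cutting there again leaves three subwalks, whose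
    sizes are at least their displacements: k, 2k and the distance from -k to
    the end, or the mirror image. The two cutting letters give the + 2. *)
Lemma walk_tour k s (w := prod s) : 0 < k -> walk s ->
  lamp (Posz k) w != 0%R -> lamp (- Posz k)%R w != 0%R ->
  4 * k + 2 <= size s + `|cursor w|.
Proof.
rewrite {}/w => k0 ws wk.
have [s1 [x [s2 [sE s1k x0 xl]]]] := walk_visit ws wk.
move: ws; rewrite {s wk}sE => /walk_cat[ws1 /walk_cons[_ ws2]].
rewrite prod_split !lampM !cursorM s1k x0 subr0 add0r size_cat /=.
have -> : lamp (- Posz k - Posz k)%R x = 0%R.
  by apply/eqP/negPn/negP => /xl; lia.
rewrite add0r => wNk.
have z2 := walk_cursor ws2.
(* If s1 leaves the lamp -k alone, it is reached after k, at -2k relative to k. *)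
have [s1Nk|s1Nk] := eqVneq (lamp (- Posz k)%R (prod s1)) 0%R.
  move: wNk; rewrite s1Nk add0r.
  move=> /(walk_visit ws2)[v1 [y [v2 [s2E v1k y0 _]]]].
  move: ws2; rewrite {z2}s2E => /walk_cat[wv1 /walk_cons[_ wv2]].
  have := walk_cursor ws1; have := walk_cursor wv1; have := walk_cursor wv2.
  rewrite prod_split !cursorM s1k v1k y0 size_cat /=; lia.
have [v1 [y [v2 [s1E v1k y0 _]]]] := walk_visit ws1 s1Nk.
move: ws1 s1k; rewrite s1E => /walk_cat[wv1 /walk_cons[_ wv2]].
have := walk_cursor wv1; have := walk_cursor wv2.
rewrite prod_split !cursorM v1k y0 size_cat /=; lia.
Qed.

(** * Lengths around the tour *)

Section TwoGenerators.
Variables (X : finite_genset G) (a t : G).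
Hypothesis gensE : gens X = [set a; t]%classic.
Hypotheses (cursor_a : cursor a = 0%R) (cursor_t : cursor t = 1%R).
Hypotheses (lamp_a0 : lamp 0%R a != 0%R).
Hypotheses (lamp_aN0 : forall i, i != 0%R -> lamp i a = 0%R).
Hypotheses (lamp_t0 : forall i, lamp i t = 0%R).
Hypothesis lamps_comm : forall k,
  commute (t ^+ k * a * t^-1 ^+ k) (t^-1 ^+ k * a * t ^+ k).
Local Notation len := (word_length X).

Lemma len_spells w : exists2 s, size s = len w & spells (gens X) s w.
Proof.
by rewrite /word_length; case: ex_minnP => m /asboolP[s [sm sw]] _; exists s.
Qed.

Lemma len_le w s : spells (gens X) s w -> len w <= size s.
Proof.
move=> sw; rewrite /word_length; case: ex_minnP => m _; apply.
by apply/asboolP; exists s.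
Qed.

Lemma len_lower k w : 0 < k ->
  lamp (Posz k) w != 0%R -> lamp (- Posz k)%R w != 0%R ->
  4 * k + 2 <= len w + `|cursor w|.
Proof.
have gw x : gens X x -> walk_step x.
  rewrite gensE => -[] ->; split=> [|i]; rewrite ?cursor_a ?cursor_t //.
    by have [->|/lamp_aN0->] := eqVneq i 0%R; rewrite ?eqxx.
  by rewrite lamp_t0 eqxx.
move=> k0; have [s <- [ls ->]] := len_spells w; apply: walk_tour => // x /ls.
by case=> /gw => [|/walk_stepV]; rewrite ?invgK.
Qed.

(** With e = t the lamp at -k is lit first, with e = t^-1 the lamp at k. *)
Definition tour k (e : G) := e^-1 ^+ k * a * e ^+ (2 * k) * a * e^-1 ^+ k.

(** The trailing e^l cancels against the way home, shortening the word by l. *)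
Lemma len_upper k l e : l <= k -> e = t \/ e = t^-1 ->
  len (tour k e * e ^+ l) + l <= 4 * k + 2.
Proof.
move=> lk eE.
pose s := nseq k e^-1 ++ a :: nseq (2 * k) e ++ a :: nseq (k - l) e^-1.
have -> : 4 * k + 2 = size s + l.
  by rewrite /s !size_cat /= size_cat /= !size_nseq; lia.
rewrite leq_add2r; apply: len_le; split.
  have ga : gens X a by rewrite gensE; left.
  have gt : gens X t by rewrite gensE; right.
  have ge : gens X e \/ gens X e^-1.
    by case: eE => ->; [left | right; rewrite invgK].
  have geV : gens X e^-1 \/ gens X e^-1^-1.
    by rewrite invgK; case: ge; [right | left].
  move=> x; rewrite /s !(mem_cat, inE) !mem_nseq.
  by do !case/orP; try (by case/andP=> _ /eqP->); move=> /eqP->; left.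
have P m (x : G) : \prod_(y <- nseq m x) y = x ^+ m.
  by rewrite big_nseq; elim: m => //= m ->; rewrite expgS.
rewrite /s big_cat big_cons big_cat big_cons !P /tour /= !mulgA.
rewrite -[LHS]mulgA; congr (_ * _).
have -> : e^-1 ^+ k = e^-1 ^+ (k - l) * e^-1 ^+ l by rewrite -expgnDr subnK.
by rewrite [e^-1 ^+ l]expVgn -mulgA mulVg mulg1.
Qed.

(** The two tours light the same two lamps in opposite orders. *)
Lemma tourV k : tour k t^-1 = tour k t.
Proof.
have := lamps_comm k; rewrite /commute /tour invgK !mulgA => E.
by rewrite mul2n -addnn !expgnDr !mulgA E.
Qed.

(** The case x = 1 gives the exact length along the seesaw. In the other case
    l < k keeps the letter x away from the lamps k and -k. *)
Lemma len_tour_lower k l e x : 0 < k -> e = t \/ e = t^-1 ->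
  x = 1 \/ (x = a \/ x = a^-1) /\ l < k ->
  4 * k + 2 <= len (tour k t * e ^+ l * x) + l.
Proof.
move=> k0 eE xE.
have x0 : cursor x = 0%R.
  by case: xE => [->|[[]-> _]]; rewrite ?cursorV ?cursor1 ?cursor_a ?oppr0.
have cW : cursor (tour k t) = 0%R.
  by rewrite /tour !(cursorM, cursorX, cursorV, cursor_a, cursor_t); lia.
have ce : `|cursor (e ^+ l)| = l.
  by rewrite cursorX; case: eE => ->; rewrite ?cursorV cursor_t; lia.
have tV i : lamp i t^-1 = 0%R by rewrite lampV lamp_t0 oppr0.
have le i : lamp i e = 0%R by case: eE => ->.
have xl i : `|i| = k -> lamp (i - cursor (e ^+ l)) x = 0%R.
  move=> ik; case: xE => [->|[xa lk]]; first exact: lamp1.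
  have iN0 : (i - cursor (e ^+ l))%R != 0%R by apply/eqP; lia.
  by case: xa => ->; rewrite ?lampV ?cursor_a ?addr0 lamp_aN0 ?oppr0.
have lW i : lamp i (tour k t) = (lamp (i + Posz k) a + lamp (i - Posz k) a)%R.
  rewrite /tour !(lampM, cursorM, cursorX, cursorV, cursor_a, cursor_t).
  rewrite !lampX // !add0r !addr0; congr (lamp _ a + lamp _ a)%R; lia.
have lWx i : lamp i (tour k t * e ^+ l * x) =
    (lamp i (tour k t) + lamp (i - cursor (e ^+ l)) x)%R.
  move: (tour k t) cW => W cW.
  by rewrite 2!lampM cursorM cW add0r lampX // addr0.
(* Only the l outside the length is the final displacement. *)
have {2}<- : `|cursor (tour k t * e ^+ l * x)| = l.
  by rewrite cursorM x0 addr0 cursorM cW add0r.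
apply: len_lower => //; rewrite lWx lW xl ?addr0; try lia.
  by rewrite subrr lamp_aN0 ?add0r //; apply/eqP; lia.
by rewrite addNr [X in (_ + X)%R]lamp_aN0 ?addr0 //; apply/eqP; lia.
Qed.

Lemma tour_seesaw k : 0 < k -> seesaw_word X k (tour k t) t.
Proof.
move=> k0.
have len_e e l : e = t \/ e = t^-1 -> l <= k ->
    len (tour k t * e ^+ l) + l = 4 * k + 2.
  move=> eE lk; apply/eqP; rewrite eqn_leq; apply/andP; split.
    rewrite -[X in len (X * _)](_ : tour k e = _) ?len_upper //.
    by case: eE => -> //; apply: tourV.
  by rewrite -[X in len X]mulg1 len_tour_lower //; left.
have len_a e l : e = t \/ e = t^-1 -> l < k -> forall h, gens X h -> h <> t ->
    len (tour k t * e ^+ l) <= len (tour k t * e ^+ l * h) /\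
    len (tour k t * e ^+ l) <= len (tour k t * e ^+ l * h^-1).
  move=> eE lk h; rewrite gensE => -[->|->] // _.
  by split; rewrite -(leq_add2r l) len_e ?(ltnW lk) //;
    apply: len_tour_lower => //; right; split=> //; [left|right].
have len_0 : len (tour k t) = 4 * k + 2.
  by rewrite -(len_e t 0) ?addn0 ?mulg1 //; left.
have a_long h : gens X h -> h <> t ->
    len (tour k t) <= len (tour k t * h) /\ len (tour k t) <= len (tour k t * h^-1).
  by move=> gh ht; have := len_a t 0 (or_introl erefl) k0 h gh ht; rewrite mulg1.
have len_S e l : e = t \/ e = t^-1 -> l < k ->
    (len (tour k t * e ^+ l.+1)).+1 = len (tour k t * e ^+ l).
  by move=> eE lk; apply: (@addIn l); rewrite addSnnS !len_e // ltnW.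
have side e : e = t \/ e = t^-1 -> seesaw_side X k (tour k t) t e.
  move=> eE [//|l] lk; rewrite subSS subn0; have {}lk : l < k by lia.
  by split; [apply: len_S | apply: len_a].
split; [split | exact: a_long | by apply: side; left | by apply: side; right].
  split; first by rewrite gensE; right.
  have := len_S t 0 (or_introl erefl) k0; have := len_S t^-1 0 (or_intror erefl) k0.
  by rewrite !expg1 !mulg1.
move=> h [gh [hs _]]; apply: contrapT => th.
by have [] := a_long h gh (fun ht => th (esym ht)); rewrite -hs ltnn.
Qed.
End TwoGenerators.
End LampWalk.

(** * The lamplighter group *)

Section Lamplighter.
Local Open Scope group_scope.
Variable n : nat.
Local Notation L := (lamplighter n).
Local Notation cls := (pres_class (lamp_relator n)).

Lemma class_cat u v : cls (u ++ v) = cls u * cls v :> L.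
Proof. by rewrite [RHS]pres_mulE. Qed.

Lemma class_winv u : cls (winv u) = (cls u)^-1 :> L.
Proof. by rewrite [RHS]pres_invE. Qed.

Lemma class_wcomm u v : cls (wcomm u v) = 1 :> L -> commute (cls u : L) (cls v).
Proof.
rewrite /wcomm !class_cat !class_winv mulgA -invgM => /(canRL (mulKg _)).
by rewrite invgK mulg1.
Qed.

Lemma class_nseq b m : cls (nseq m (LT, b)) =
  (if b then (lamp_t n)^-1 else lamp_t n) ^+ m :> L.
Proof.
elim: m => [|m IHm] //; rewrite expgS -IHm.
have -> : (if b then (lamp_t n)^-1 else lamp_t n) = cls [:: (LT, b)] :> L.
  by case: b {IHm} => //; rewrite -(class_winv [:: (LT, false)]).
by rewrite -class_cat.
Qed.

Lemma lamplighter_comm k (a := lamp_a n) (t := lamp_t n) :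
  commute (t ^+ k * a * t^-1 ^+ k) (t^-1 ^+ k * a * t ^+ k).
Proof.
have tE : cls (wexp LT (Posz k)) = t ^+ k :> L by apply: (class_nseq false).
have tVE : cls (wexp LT (- Posz k)%R) = t^-1 ^+ k :> L.
  by case: k {tE} => [|k] //; apply: (class_nseq true).
have conjE i : cls (lamp_conj i) = cls (wexp LT i) * a * cls (wexp LT (- i)%R) :> L.
  by rewrite /lamp_conj !class_cat mulgA.
have := conjE (Posz k); have := conjE (- Posz k)%R.
rewrite GRing.opprK tE tVE => <- <-.
by apply/class_wcomm/pres_eqP/pres_rel/lamp_relator_comm.
Qed.

Hypothesis hn : 1 < n.

(** Defined through a representative word; pres_cong_config makes the choice
    irrelevant. *)
Definition cursor (x : L) : int := word_pos (repr x).
Definition lamp (i : int) (x : L) : 'Z_n := word_lamp n i (repr x).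

Lemma cursor_class u : cursor (cls u) = word_pos u.
Proof. by have [] := pres_cong_config hn (pres_repr (lamp_relator n) u). Qed.

Lemma lamp_class i u : lamp i (cls u) = word_lamp n i u.
Proof.
by rewrite /lamp; have [_ ->] := pres_cong_config hn (pres_repr (lamp_relator n) u).
Qed.

Lemma cursor_mul (x y : L) : cursor (x * y) = (cursor x + cursor y)%R.
Proof.
elim/pres_classW: x => u; elim/pres_classW: y => v.
by rewrite [_ * _]pres_mulE !cursor_class word_pos_cat.
Qed.

Lemma lamp_mul i (x y : L) :
  lamp i (x * y) = (lamp i x + lamp (i - cursor x) y)%R.
Proof.
elim/pres_classW: x => u; elim/pres_classW: y => v.
by rewrite [_ * _]pres_mulE !lamp_class cursor_class word_lamp_cat.
Qed.

End Lamplighter.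

Theorem theorem4p5 (n : nat) (hn : 2 <= n) (k : nat) (hk : 0 < k) :
  exists w : lamplighter n, seesaw_word (lamp_gens n) k w (lamp_t n).
Proof.
exists (tour (lamp_a n) k (lamp_t n)).
apply: (tour_seesaw (cursor_mul hn) (lamp_mul hn)) => //.
- by rewrite cursor_class // /word_pos big_seq1.
- by rewrite cursor_class // /word_pos big_seq1.
- by rewrite lamp_class // /= GRing.addr0 GRing.oner_eq0.
- by move=> i /negPf i0; rewrite lamp_class //= /letter_lamp /= i0 GRing.addr0.
- by move=> i; rewrite lamp_class //= GRing.addr0.
- exact: lamplighter_comm.
Qed.
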